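(* Let $X$ be a continuum and let $f\colon X\to X$ be a cw1-expansive homeomorphism. If its stable and unstable atlases $\mathcal F^s=\mathcal A^s$, $\mathcal F^u=\mathcal A^u$ form a generating pair, then $f$ is expansive.
   Context: A continuum is a compact connected metric space. $f$ is cw1-expansive if there is $\delta>0$ such that whenever $A,B\subset X$ are continua with $\operatorname{diam}(f^n(A))\le\delta$ for all $n\ge0$ and $\operatorname{diam}(f^n(B))\le\delta$ for all $n\le 0$, the set $A\cap B$ has at most one point. $f$ is expansive if there is $\delta>0$ such that $\operatorname{dist}(f^n(x),f^n(y))<\delta$ for all $n\in\mathbb Z$ implies $x=y$. For $Y\subset X$ and $x\in Y$, $\operatorname{Comp}_x(Y)$ is the connected component of $Y$ containing $x$; $\mathcal C(Y)$ is the set of non-empty subcontinua of $Y$. A decomposition of a compact set $Y\subset X$ is a map $Q\colon Y\to\mathcal C(Y)$ with $x\in Q(x)$ for all $x$, any two values equal or disjoint, and upper semicontinuous: for all $x\in Y$ and every open $V\supset Q(x)$ there is a neighborhood $W$ of $x$ with $Q(y)\subset V$ for all $y\in W\cap Y$. Stable and unstable atlases. A continuum $C\subset X$ is stable if $\operatorname{diam}(f^n(C))\to0$ as $n\to+\infty$, and unstable if $\operatorname{diam}(f^n(C))\to 0$ as $n\to-\infty$. For closed $Y\subset X$ and $x\in Y$, $Q^s_Y(x)$ (resp. $Q^u_Y(x)$) is the set of $y\in Y$ such that some stable (resp. unstable) continuum $C\subset Y$ contains $x$ and $y$. $\mathcal U^s$ is the set of open $U\subset X$ such that $Q^s_{\overline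 U}$ is a decomposition of $\overline U$ all of whose values are stable continua; $\mathcal A^s=\{Q^s_{\overline U}:U\in\mathcal U^s\}$; $\mathcal U^u,\mathcal A^u$ are defined analogously with unstable continua. (For cw-expansive, in particular cw1-expansive, $f$ both $\mathcal U^s$ and $\mathcal U^u$ are bases of the topology of $X$ closed under passing to open subsets.) For $x\in U\in\mathcal U^\sigma$ put $Q^\sigma_U(x)=\operatorname{Comp}_x(Q^\sigma_{\overline U}(x)\cap U)$. Generating pair: $\mathcal A^s,\mathcal A^u$ form a generating pair if for every ball $B_\epsilon(x)\in\mathcal U^s\cap\mathcal U^u$ there is $\delta>0$ such that if $y\in B_\delta(x)$ then $Q^s_{B_\epsilon(x)}(x)\cap Q^u_{B_\epsilon(x)}(y)\neq\emptyset$ and $Q^u_{B_\epsilon(x)}(x)\cap Q^s_{B_\epsilon(x)}(y)\neq\emptyset$. *)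

(* Defs.v *)
From HB Require Import structures.
From mathcomp Require Import all_boot all_order all_algebra.
From mathcomp Require Import all_classical all_reals all_analysis.

Set Implicit Arguments.
Unset Strict Implicit.
Unset Printing Implicit Defensive.

Import Order.TTheory GRing.Theory Num.Theory.
Import numFieldNormedType.Exports.

Local Open Scope classical_set_scope.
Local Open Scope ring_scope.

Record homeo (T : topologicalType) := Homeo {
  homeo_fun :> T -> T;
  homeo_inv : T -> T;
  homeo_funK : cancel homeo_fun homeo_inv;
  homeo_invK : cancel homeo_inv homeo_fun;
  homeo_fun_continuous : continuous homeo_fun;
  homeo_inv_continuous : continuous homeo_inv }.

(* The integer iterate f^n; recall that Negz k denotes -(k+1). *)
Definition iterz (T : topologicalType) (f : homeo T) (n : int) : T -> T :=
  match n with
  | Posz k => iter k (homeo_fun f)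
  | Negz k => iter k.+1 (homeo_inv f)
  end.

Section Continua.
Context {R : realType} {X : metricType R}.
Implicit Types (A B C U V Y : set X) (Q : X -> set X) (f : homeo X).

(* The empty set is a continuum here; non-emptiness is required explicitly
   where it matters. *)
Definition continuum A := compact A /\ connected A.

(* In a compact space the set of distances is bounded, so that sup is the true
   supremum; the diameter of the empty set is 0. *)
Definition diam A : R := sup [set mdist x y | x in A & y in A].

Definition cw1_expansive f :=
  exists2 delta : R, 0 < delta &
    forall A B, continuum A -> continuum B ->
      (forall n : int, 0 <= n -> diam (iterz f n @` A) <= delta) ->
      (forall n : int, n <= 0 -> diam (iterz f n @` B) <= delta) ->
      is_subset1 (A `&` B).

Definition expansive f :=
  exists2 delta : R, 0 < delta &
    forall x y : X,
      (forall n : int, mdist (iterz f n x) (iterz f n y) < delta) -> x = y.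

Definition upper_semicontinuous_on Y Q :=
  forall x, Y x -> forall V, open V -> Q x `<=` V ->
    \forall y \near x, Y y -> Q y `<=` V.

(* A map on Y is a function on X whose values outside Y are irrelevant. *)
Definition decomposition Y Q :=
  [/\ forall x, Y x -> [/\ Q x !=set0, Q x `<=` Y & continuum (Q x)],
      forall x, Y x -> Q x x,
      forall x y, Y x -> Y y -> Q x = Q y \/ Q x `&` Q y = set0
    & upper_semicontinuous_on Y Q].

Definition stable f C :=
  continuum C /\ diam (iterz f n%:Z @` C) @[n --> \oo] --> (0 : R).

Definition unstable f C :=
  continuum C /\ diam (iterz f (- n%:Z) @` C) @[n --> \oo] --> (0 : R).

(* A family of decompositions of the closures of open sets, indexed by the open
   sets themselves: the leaf through x in U depends on U, not only on the
   decomposition of its closure. *)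
Record atlas := Atlas {
  atlas_dom : set (set X);
  atlas_map : set X -> X -> set X;
  atlas_open : forall U, atlas_dom U -> open U;
  atlas_decomposition :
    forall U, atlas_dom U -> decomposition (closure U) (atlas_map U) }.

Definition local_leaf (F : atlas) U (x : X) : set X :=
  connected_component (atlas_map F U x `&` U) x.

Definition generating_pair (F G : atlas) :=
  forall (x : X) (eps : R), 0 < eps ->
    let U := ball x eps in
    atlas_dom F U -> atlas_dom G U ->
    exists2 delta : R, 0 < delta &
      forall y, ball x delta y ->
        local_leaf F U x `&` local_leaf G U y !=set0 /\
        local_leaf G U x `&` local_leaf F U y !=set0.

Section Asymptotic.
(* The class of continua used to join points: stable f or unstable f. *)
Variable S : set (set X).

Definition Qmap Y (x : X) : set X :=
  [set y | exists C, [/\ S C, C `<=` Y, C x & C y]].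

Definition Qdom : set (set X) :=
  [set U | [/\ open U, decomposition (closure U) (Qmap (closure U))
             & forall x, closure U x -> S (Qmap (closure U) x)]].

Lemma Qdom_open U : Qdom U -> open U.
Proof. by case. Qed.

Lemma Qdom_decomposition U :
  Qdom U -> decomposition (closure U) (Qmap (closure U)).
Proof. by case. Qed.

Definition Qatlas : atlas := Atlas Qdom_open Qdom_decomposition.

End Asymptotic.

Definition stable_atlas f : atlas := Qatlas (stable f).
Definition unstable_atlas f : atlas := Qatlas (unstable f).

End Continua.

Arguments atlas {R} X.

(* Main.v *)
(* The generating condition is local and not uniform, so it gives no product
   structure, but two of its consequences are uniform by compactness.  First,
   nearby points x, y are connected by short continua, unstable from x to some
   a, stable from a to some b, unstable from b to y: project both points to the
   stable leaf of a common centre.  Second, two nearby points on a common tame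
   stable continuum lie on a common short one: their projections to the unstable
   leaf of the centre are related both stably and unstably, hence equal.
   Suppose now that the forward orbits of x and y stay close.  Connect f^n x to
   f^n y as above and pull back n times, shortening the stable continuum at each
   step by the second fact; the unstable ends contract to x and y.  As n grows
   this yields a stable continuum through x and y.  Symmetrically the backward
   orbits yield an unstable one, so x = y by cw1-expansivity.
   That small balls belong to both atlases rests on Kato's lemma: a stable
   continuum of small diameter has small forward iterates. *)
Require Import Defs.
From HB Require Import structures.
From mathcomp Require Import all_boot all_order all_algebra.
From mathcomp Require Import all_classical all_reals all_analysis.
From mathcomp Require Import lra zify.

Set Implicit Arguments.
Unset Strict Implicit.
Unset Printing Implicit Defensive.

Import Order.TTheory GRing.Theory Num.Theory.
Import numFieldNormedType.Exports.

Local Open Scope classical_set_scope.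
Local Open Scope ring_scope.

(* The unqualified name denotes the version for normed modules. *)
Local Notation cvg_mdist := metricType_numDomainType.cvgrPdist_lt.

(** * Connectedness through chains of small steps *)

Section FineConnectedness.
Context {R : realType} {X : metricType R}.
Implicit Types (A P : set X) (e : R).

Lemma open_ball (x : X) e : open (ball x e).
Proof.
rewrite openE => y; rewrite ballEmdist /= => xy.
rewrite /interior -nbhs_ballE; exists (e - mdist x y); rewrite /= ?subr_gt0//.
by rewrite ballEmdist => z /= yz; have := metric_triangle x y z; lra.
Qed.

(* A form of connectedness that makes sense for finite chains of points and
   becomes genuine connectedness in the limit e -> 0. *)
Definition finely_connected A e :=
  forall P, A `&` P !=set0 -> A `\` P !=set0 ->
  exists c c', [/\ A c, P c, A c', ~ P c' & mdist c c' <= e].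

(** If no short step leaves [P], the [e]-neighbourhoods of the two parts of [A] show that the part
    in [P] is both open and closed in [A]. *)
Lemma connected_finely A e : 0 < e -> connected A -> finely_connected A e.
Proof.
move=> e0 Ac P [a [Aa Pa]] [b [Ab Pb]]; apply: contrapT => nstep.
pose B := A `&` P.
suff AB : B = A by apply: Pb; move: Ab; rewrite -AB => -[].
apply: Ac; first by exists a.
- exists (\bigcup_(x in B) ball x e).
    by apply: bigcup_open => x _; exact: open_ball.
  apply/seteqP; split => [x Bx|x [Ax [y [Ay Py]]]].
    by split; [case: Bx|exists x => //; exact: ballxx].
  rewrite ballEmdist /= => xy; split => //; apply: contrapT => nPx.
  by apply: nstep; exists y, x; split => //; exact: ltW.
- exists (~` \bigcup_(x in A `\` P) ball x e).
    by rewrite closedC; apply: bigcup_open => x _; exact: open_ball.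
  apply/seteqP; split => [x [Ax Px]|x [Ax nU]].
    split => // -[y [Ay nPy]]; rewrite ballEmdist /= => xy.
    by apply: nstep; exists x, y; split => //; rewrite metric_sym ltW.
  by split => //; apply: contrapT => nPx; apply: nU; exists x => //; exact: ballxx.
Qed.

End FineConnectedness.

(** * Limits of sets along an ultrafilter *)

Section UltraLimits.
Context {R : realType} {X : metricType R}.
Implicit Types (E : nat -> set X) (e : R).
Hypothesis X_compact : compact [set: X].
Context {F : set_system nat} {FU : UltraFilter F}.

(** The Kuratowski limit of [E] along [F]; for an ultrafilter the upper and lower limits agree, so
    no subsequences have to be extracted. *)
Definition ultralimit E : set X :=
  [set z | forall e, 0 < e -> \forall k \near F, exists2 c, E k c & mdist z c < e].

Lemma ultra_cvg (c : nat -> X) : exists z : X, c @ F --> z.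
Proof.
have [G [GU FG]] := @ultraFilterLemma X (fmap c F) (fmap_proper_filter c _).
have := X_compact; rewrite compact_ultra => /(_ G GU filterT) [z [_ Gz]].
exists z; apply/cvg_mdist => e e0.
have [//|far] := in_ultra_setVsetC [set k | mdist z (c k) < e] FU.
have Gfar : G (~` ball z e) by apply: FG; rewrite ballEmdist.
by have [x [xz]] := filter_ex (filterI (Gz _ (nbhsx_ballx z _ e0)) Gfar).
Qed.

Lemma mem_ultralimit E (c : nat -> X) z :
  (\forall k \near F, E k (c k)) -> c @ F --> z -> ultralimit E z.
Proof.
move=> Ec /cvg_mdist cz e e0.
by apply: filterS (filterI Ec (cz e e0)) => k [Ek zk]; exists (c k).
Qed.

Lemma closed_ultralimit E : closed (ultralimit E).
Proof.
move=> z clz e e0; have e20 : 0 < e / 2 by lra.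
have [w [Lw]] := clz _ (nbhsx_ballx z _ e20).
rewrite ballEmdist /= => zw.
apply: filterS (Lw _ e20) => k [c Ec wc]; exists c => //.
by have := metric_triangle z w c; lra.
Qed.

Lemma ultralimit_sub E Y : closed Y -> (\forall k \near F, E k `<=` Y) ->
  ultralimit E `<=` Y.
Proof.
move=> Ycl EY z Lz; rewrite ((closure_id Y).1 Ycl) => U /nbhs_ballP [e e0 zU].
have [k [EkY [c Ec zc]]] := filter_ex (filterI EY (Lz e e0)).
by exists c; split; [exact: EkY|apply: zU; rewrite ballEmdist].
Qed.

Lemma ultralimit_mdist E (phi : X -> X) e : continuous phi ->
  (\forall k \near F, forall x y, E k x -> E k y -> mdist (phi x) (phi y) <= e) ->
  forall x y, ultralimit E x -> ultralimit E y -> mdist (phi x) (phi y) <= e.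
Proof.
move=> cphi Ee x y Lx Ly; apply/ler_addgt0Pl => r r0.
have r20 : 0 < r / 2 by lra.
have /cvg_mdist /(_ _ r20) /nbhs_ballP [a a0 xa] := cphi x.
have /cvg_mdist /(_ _ r20) /nbhs_ballP [b b0 yb] := cphi y.
have [k [Ek [[c Ec xc] [d Ed yd]]]] :=
  filter_ex (filterI Ee (filterI (Lx a a0) (Ly b b0))).
have := Ek c d Ec Ed.
have /= := xa c; rewrite ballEmdist => /(_ xc).
have /= := yb d; rewrite ballEmdist => /(_ yd).
have := metric_triangle (phi x) (phi c) (phi y).
have := metric_triangle (phi c) (phi d) (phi y).
rewrite (metric_sym (phi d)); lra.
Qed.

Lemma near_choice T (t0 : T) (Q : nat -> T -> Prop) :
  (\forall k \near F, exists t, Q k t) ->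
  exists t : nat -> T, \forall k \near F, Q k (t k).
Proof.
move=> FQ; have : forall k, exists t, (exists s, Q k s) -> Q k t.
  move=> k; have [[t Qt]|n] := pselect (exists s, Q k s); first by exists t.
  by exists t0.
by move=> /choice [t tQ]; exists t; apply: filterS FQ => k; exact: tQ.
Qed.

(** If the limit split into disjoint non-empty closed sets [B] and [D], separated by an open [P],
    then [E k] would contain a step of length at most [r k] leaving [P]. Both ends of these steps
    tend to the same point of the limit, which can lie neither in [B] nor in [D]. *)
Lemma continuum_ultralimit E (r : nat -> R) :
  (forall e, 0 < e -> \forall k \near F, r k < e) ->
  (\forall k \near F, finely_connected (E k) (r k)) ->
  continuum (ultralimit E).
Proof.
move=> r0 Er; split; first exact: (subclosed_compact (@closed_ultralimit E) X_compact).
move=> B [b Bb] [W oW BO] [K cK BK]; apply: contrapT => BL.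
pose D := ultralimit E `\` W.
have clB : closed B.
  by rewrite BK; apply: closedI => //; exact: closed_ultralimit.
have clD : closed D.
  rewrite /D setDE; apply: closedI; first exact: closed_ultralimit.
  exact: open_closedC.
have [d Dd] : D !=set0.
  apply: contrapT => D0; apply: BL; rewrite BO; apply/seteqP; split => [x []//|x Lx].
  by split => //; apply: contrapT => nO; apply: D0; exists x.
have BD x : B x -> D x -> False by rewrite BO => -[_ Ox] [_].
have nX := compact_normal (@metric_hausdorff _ X) X_compact.
have : set_nbhs B (~` D).
  by apply/set_nbhsP; exists (~` D); split;
    [exact: closed_openC|move=> x Bx Dx; exact: (BD x)|by []].
move=> /(nX _ clB) [V /set_nbhsP [P [oP BP PV]] VD].
have inP x : B x -> nbhs x P by move=> Bx; apply: open_nbhs_nbhs; split => //; exact: BP.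
have outP x : D x -> nbhs x (~` P).
  move=> Dx; apply: filterS (_ : nbhs x (~` closure V)).
    by move=> y nV Py; apply: nV; apply: subset_closure; exact: PV.
  apply: open_nbhs_nbhs; split; first exact/closed_openC/closed_closure.
  by move=> /VD.
have hits x : ultralimit E x ->
    forall U, nbhs x U -> \forall k \near F, E k `&` U !=set0.
  move=> Lx U /nbhs_ballP [e e0 xW]; apply: filterS (Lx e e0) => k [c Ec xc].
  by exists c; split => //; apply: xW; rewrite ballEmdist.
have Lb : ultralimit E b by move: Bb; rewrite BO => -[].
have Ld : ultralimit E d by case: Dd.
have step : \forall k \near F, exists cc : X * X,
    [/\ E k cc.1, P cc.1, E k cc.2, ~ P cc.2 & mdist cc.1 cc.2 <= r k].
  apply: filterS (filterI Er
    (filterI (hits _ Lb _ (inP _ Bb)) (hits _ Ld _ (outP _ Dd)))).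
  move=> k [Ek [h1 h2]]; have [c [c' ?]] := Ek P h1 h2.
  by exists (c, c').
have [cc ccP] := near_choice (b, b) step.
have [z c1z] := ultra_cvg (fun k => (cc k).1).
have c2z : (fun k => (cc k).2) @ F --> z.
  apply/cvg_mdist => e e0; have e20 : 0 < e / 2 by lra.
  move/cvg_mdist : c1z => /(_ _ e20) c1z.
  apply: filterS (filterI ccP (filterI c1z (r0 _ e20))) => k [[_ _ _ _ ck] [zk rk]].
  by have := metric_triangle z (cc k).1 (cc k).2; lra.
have Lz : ultralimit E z.
  by apply: mem_ultralimit c1z; apply: filterS ccP => k [].
have [Wz|nWz] := pselect (W z).
  have Bz : B z by rewrite BO.
  have [k [[_ _ _ nP _] Pk]] := filter_ex (filterI ccP (c2z _ (inP _ Bz))).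
  exact: nP.
have [k [[_ Pk _ _ _] nP]] := filter_ex (filterI ccP (c1z _ (outP _ (conj Lz nWz)))).
exact: nP.
Qed.

End UltraLimits.

(** * Tame and asymptotic continua *)

Section Tameness.
Context {R : realType} {X : metricType R}.
Implicit Types (g : X -> X) (C D Y : set X) (e : R).

Definition tame g e C := forall n x y, C x -> C y ->
  mdist (iter n g x) (iter n g y) <= e.

(** [stable] or [unstable] with the supremum unfolded, according as [g] is the homeomorphism or its
    inverse. Keeping [g] abstract lets each argument serve both directions of time. *)
Definition asymptotic g C := continuum C /\
  forall e, 0 < e -> exists N, forall n x y, (N <= n)%N -> C x -> C y ->
  mdist (iter n g x) (iter n g y) <= e.

Definition joined g e Y x y :=
  exists C, [/\ continuum C, tame g e C, C `<=` Y, C x & C y].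

Lemma continuous_iter g n : continuous g -> continuous (iter n g).
Proof.
move=> cg; elim: n => [|n IH] x /=; first exact: cvg_id.
exact: (continuous_comp (IH x) (cg _)).
Qed.

Lemma continuum_image g C : continuous g -> continuum C -> continuum (g @` C).
Proof.
move=> cg [cC kC]; have cgC : {within C, continuous g} by exact: continuous_subspaceT.
by split; [exact: continuous_compact|exact: connected_continuous_connected].
Qed.

Lemma continuumU C D x : C x -> D x -> continuum C -> continuum D ->
  continuum (C `|` D).
Proof.
move=> Cx Dx [cC kC] [cD kD]; split; first exact: compactU.
by apply: connectedU => //; exists x.
Qed.

Lemma tameU g e e' C D x : C x -> D x -> tame g e C -> tame g e' D ->
  tame g (e + e') (C `|` D).
Proof.
move=> Cx Dx tC tD n y z Hy Hz.
have e0 := le_trans (mdist_ge0 _ _) (tC n x x Cx Cx).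
have e'0 := le_trans (mdist_ge0 _ _) (tD n x x Dx Dx).
have tr := metric_triangle (iter n g y) (iter n g x) (iter n g z).
case: Hy Hz => [Cy|Dy] [Cz|Dz].
- by have := tC n y z Cy Cz; lra.
- by have := tC n y x Cy Cx; have := tD n x z Dx Dz; lra.
- by have := tC n x z Cx Cz; have := tD n y x Dy Dx; lra.
- by have := tD n y z Dy Dz; lra.
Qed.

Lemma joined_sym g e Y x y : joined g e Y x y -> joined g e Y y x.
Proof. by move=> [C [*]]; exists C. Qed.

Lemma joined_trans g e e' Y x y z :
  joined g e Y x y -> joined g e' Y y z -> joined g (e + e') Y x z.
Proof.
move=> [C [cC tC CY Cx Cy]] [D [cD tD DY Dy Dz]]; exists (C `|` D); split.
- exact: continuumU Cy Dy cC cD.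
- exact: tameU Cy Dy tC tD.
- by rewrite subUset.
- by left.
- by right.
Qed.

Lemma joined_le g e e' Y x y : e <= e' -> joined g e Y x y -> joined g e' Y x y.
Proof.
move=> ee' [C [cC tC CY Cx Cy]]; exists C; split => // n a b Ca Cb.
exact: le_trans (tC n a b Ca Cb) ee'.
Qed.

Lemma joined_mdist g e Y x y n : joined g e Y x y ->
  mdist (iter n g x) (iter n g y) <= e.
Proof. by move=> [C [_ tC _ Cx Cy]]; exact: tC. Qed.

End Tameness.

(** * Uniformity and closedness from compactness *)

Section Compactness.
Context {R : realType} {X : metricType R}.
Hypothesis X_compact : compact [set: X].
Context {F : set_system nat} {FU : UltraFilter F}.
Hypothesis F_infty : \oo `<=` F.

Lemma near_invS (e : R) : 0 < e -> \forall k \near F, k.+1%:R^-1 < e.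
Proof. by move=> e0; apply: F_infty; exact: (near_infty_natSinv_lt (PosNum e0)). Qed.

Lemma near_geq N : \forall k \near F, (N <= k)%N.
Proof. by apply: F_infty; exact: nbhs_infty_ge. Qed.

Lemma ultra_cvg_close (a b : nat -> X) (z : X) : a @ F --> z ->
  (forall e, 0 < e -> \forall k \near F, mdist (a k) (b k) < e) -> b @ F --> z.
Proof.
move=> /cvg_mdist az ab.
apply/cvg_mdist => e e0; have e20 : 0 < e / 2 by lra.
apply: filterS (filterI (az _ e20) (ab _ e20)) => k [zk abk].
by have := metric_triangle z (a k) (b k); lra.
Qed.

(** A Lebesgue number argument: bad pairs at distance tending to 0 would accumulate at a single [z].
    This is what makes the local generating condition uniform. *)
Lemma uniformly_local (P : X -> X -> Prop) :
  (forall z, exists2 r : R, 0 < r &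
    forall x y, mdist z x < r -> mdist z y < r -> P x y) ->
  exists2 d : R, 0 < d & forall x y, mdist x y < d -> P x y.
Proof.
move=> loc; apply: contrapT => nunif.
have : forall k : nat, exists xy : X * X,
    mdist xy.1 xy.2 < k.+1%:R^-1 /\ ~ P xy.1 xy.2.
  move=> k; apply: contrapT => nk; apply: nunif; exists (k.+1%:R^-1) => // x y xy.
  by apply: contrapT => nP; apply: nk; exists (x, y).
move=> /choice [xy xyP].
have [z xz] := ultra_cvg X_compact (fun k => (xy k).1).
have yz : (fun k => (xy k).2) @ F --> z.
  apply: ultra_cvg_close xz _ => e e0; apply: filterS (near_invS e0) => k ke.
  by have [xyk _] := xyP k; exact: lt_trans xyk ke.
have [r r0 Pr] := loc z.
move/cvg_mdist : xz => /(_ _ r0) xz.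
move/cvg_mdist : yz => /(_ _ r0) yz.
have [k [xk yk]] := filter_ex (filterI xz yz).
by have [_] := xyP k; apply; exact: Pr.
Qed.

Lemma uniformly_continuous (phi : X -> X) (e : R) : continuous phi -> 0 < e ->
  exists2 d : R, 0 < d & forall x y, mdist x y < d -> mdist (phi x) (phi y) <= e.
Proof.
move=> cphi e0; apply: uniformly_local => z; have e20 : 0 < e / 2 by lra.
have /cvg_mdist /(_ _ e20) /nbhs_ballP [r r0 zr] := cphi z.
exists r => // x y zx zy.
have /= := zr x; rewrite ballEmdist => /(_ zx).
have /= := zr y; rewrite ballEmdist => /(_ zy).
have := metric_triangle (phi x) (phi z) (phi y).
rewrite (metric_sym (phi x) (phi z)); lra.
Qed.

Lemma uniformly_continuous_iter (g : X -> X) N (e : R) : continuous g -> 0 < e ->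
  exists2 d : R, 0 < d & forall n x y, (n < N)%N -> mdist x y < d ->
    mdist (iter n g x) (iter n g y) <= e.
Proof.
move=> cg e0; elim: N => [|N [d d0 IH]]; first by exists 1.
have [d' d'0 H] := uniformly_continuous (@continuous_iter _ _ g N cg) e0.
exists (Num.min d d') => [|n x y]; first by rewrite lt_min d0.
rewrite ltnS leq_eqVlt lt_min => /orP[/eqP->|nN] /andP[xd xd']; [exact: H|exact: IH].
Qed.

(** The ultralimit of the joining continua joins the limit points, because tameness bounds each
    iterate by a closed condition. *)
Lemma joined_lim g (e : R) Y (a b : nat -> X) (x y : X) : continuous g -> closed Y ->
  a @ F --> x -> b @ F --> y -> (\forall k \near F, joined g e Y (a k) (b k)) ->
  joined g e Y x y.
Proof.
move=> cg cY ax bY /(near_choice set0) [C HC].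
exists (ultralimit (F := F) C); split.
- apply: (@continuum_ultralimit _ _ X_compact _ _ _ (fun k => k.+1%:R^-1)).
    exact: near_invS.
  by apply: filterS HC => k [[_ Ck] _ _ _ _]; exact: connected_finely.
- move=> n; apply: ultralimit_mdist; first exact: continuous_iter.
  by apply: filterS HC => k [_ tC _ _ _] u v; exact: tC.
- by apply: ultralimit_sub => //; apply: filterS HC => k [].
- by apply: mem_ultralimit ax; apply: filterS HC => k [].
- by apply: mem_ultralimit bY; apply: filterS HC => k [].
Qed.

End Compactness.

(** * Uniform contraction, Kato's lemma and small leaves *)

Section Separation.
Context {R : realType} {X : metricType R}.
Hypothesis X_compact : compact [set: X].
Context {F : set_system nat} {FU : UltraFilter F}.
Hypothesis F_infty : \oo `<=` F.
Variables (g h : X -> X) (d0 : R).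
Hypotheses (g_cont : continuous g) (h_cont : continuous h) (gK : cancel g h).
Hypothesis d0_gt0 : 0 < d0.
Hypothesis separating : forall A B, continuum A -> continuum B ->
  tame g d0 A -> tame h d0 B -> is_subset1 (A `&` B).

Lemma iter_cancel m n x : (n <= m)%N -> iter n h (iter m g x) = iter (m - n) g x.
Proof.
elim: n => [|n IH] nm; first by rewrite subn0.
by rewrite iterS (IH (ltnW nm)) -(@subnSK n m nm) iterS gK.
Qed.

(** The limit [L] of the iterates at times [m k] is tame for [g], and also for [h] since any fixed
    number of backward steps is eventually at most [m k]. Separation of [L] from itself makes it a
    single point. Only fine connectedness is asked of the iterates, so that the pieces cut out by
    [tame_piece] qualify. *)
Lemma no_persistent_spread
    (D : nat -> set X) (m : nat -> nat) (u w : nat -> X) (e : R) :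
  0 < e -> (forall N, \forall k \near F, (N <= m k)%N) ->
  (forall k, tame g d0 (D k)) ->
  (forall k, finely_connected (iter (m k) g @` D k) k.+1%:R^-1) ->
  (forall k, D k (u k)) -> (forall k, D k (w k)) ->
  ~ (forall k, e <= mdist (iter (m k) g (u k)) (iter (m k) g (w k))).
Proof.
move=> e0 moo tD fD Du Dw far.
pose E k := iter (m k) g @` D k.
pose L := ultralimit (F := F) E.
have Lc : continuum L.
  apply: (@continuum_ultralimit _ _ X_compact _ _ _ (fun k => k.+1%:R^-1)).
    exact: near_invS.
  by apply: nearW => k; exact: fD.
have Lg : tame g d0 L.
  move=> n; apply: ultralimit_mdist; first exact: continuous_iter.
  apply: nearW => k _ _ [a Da <-] [b Db <-].
  by rewrite -!iterD; exact: (tD k).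
have Lh : tame h d0 L.
  move=> n; apply: ultralimit_mdist; first exact: continuous_iter.
  apply: filterS (moo n) => k nk _ _ [a Da <-] [b Db <-].
  by rewrite !iter_cancel//; exact: (tD k).
have [p up] := ultra_cvg X_compact (fun k => iter (m k) g (u k)).
have [q wq] := ultra_cvg X_compact (fun k => iter (m k) g (w k)).
have Lp : L p.
  by apply: mem_ultralimit up; apply: nearW => k; exists (u k).
have Lq : L q.
  by apply: mem_ultralimit wq; apply: nearW => k; exists (w k).
have pq : p = q by apply: (separating Lc Lc Lg Lh).
have e20 : 0 < e / 2 by lra.
move/cvg_mdist : up => /(_ _ e20) up.
move/cvg_mdist : wq => /(_ _ e20) wq.
have [k [pk qk]] := filter_ex (filterI up wq).
have := far k; have := metric_triangle (iter (m k) g (u k)) p (iter (m k) g (w k)).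
rewrite (metric_sym _ p); move: qk; rewrite -pq; lra.
Qed.

Lemma uniform_contraction (e : R) : 0 < e -> exists N, forall C n x y,
  continuum C -> tame g d0 C -> (N <= n)%N -> C x -> C y ->
  mdist (iter n g x) (iter n g y) <= e.
Proof.
move=> e0; apply: contrapT => bad.
have : forall N : nat, exists t : (set X * nat) * (X * X),
    [/\ [/\ continuum t.1.1, tame g d0 t.1.1 & (N <= t.1.2)%N],
        t.1.1 t.2.1, t.1.1 t.2.2
      & e <= mdist (iter t.1.2 g t.2.1) (iter t.1.2 g t.2.2)].
  move=> N; apply: contrapT => nN; apply: bad; exists N => C n x y cC tC Nn Cx Cy.
  rewrite leNgt; apply/negP => exy; apply: nN; exists ((C, n), (x, y)).
  by split => //=; exact: ltW.
move=> /choice [t tP].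
apply: (@no_persistent_spread (fun k => (t k).1.1) (fun k => (t k).1.2)
          (fun k => (t k).2.1) (fun k => (t k).2.2) e).
- by [].
- move=> N; apply: filterS (near_geq F_infty N) => k Nk.
  by have [[_ _ kt] _ _ _] := tP k; exact: leq_trans Nk kt.
- by move=> k; have [[]] := tP k.
- move=> k; apply: connected_finely => //.
  have [[cC _ _] _ _ _] := tP k.
  by have [] := continuum_image (@continuous_iter _ _ g (t k).1.2 g_cont) cC.
- by move=> k; have [] := tP k.
- by move=> k; have [] := tP k.
- by move=> k; have [] := tP k.
Qed.

Lemma tame_asymptotic (e : R) C : e <= d0 -> continuum C -> tame g e C -> asymptotic g C.
Proof.
move=> ed cC tC; split => // r r0; have [N HN] := uniform_contraction r0.
exists N => n x y Nn Cx Cy; apply: HN Cx Cy => // k a b Ca Cb.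
exact: le_trans (tC k a b Ca Cb) ed.
Qed.

(** Fine connectedness for the distance taken over all iterates at once: late iterates of [C] are
    small anyway, and the finitely many early ones are uniformly continuous. *)
Lemma asymptotic_fine_step C (r : R) P : 0 < r -> asymptotic g C ->
  C `&` P !=set0 -> C `\` P !=set0 ->
  exists c c', [/\ C c, P c, C c', ~ P c' &
    forall n, mdist (iter n g c) (iter n g c') <= r].
Proof.
move=> r0 [[cC kC] sC] CP CnP; have [N HN] := sC _ r0.
have [d dd0 Hd] := uniformly_continuous_iter X_compact F_infty N g_cont r0.
have d20 : 0 < d / 2 by lra.
have [c [c' [Cc Pc Cc' Pc' cc']]] := connected_finely d20 kC CP CnP.
exists c, c'; split => // n; have [Nn|nN] := leqP N n; first exact: HN.
by apply: Hd => //; lra.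
Qed.

(* Boundary bumping for the distance sup_n d(g^n x, g^n y), in a discrete form. *)
Lemma tame_piece C u v n (e r : R) : 0 < r <= e / 4 -> asymptotic g C ->
  C u -> C v -> e < mdist (iter n g u) (iter n g v) ->
  exists D w m, [/\ D `<=` C, tame g e D,
    forall k, finely_connected (iter k g @` D) r, D u /\ D w
    & e / 4 <= mdist (iter m g u) (iter m g w)].
Proof.
move=> /andP[r0 re] aC Cu Cv uv.
(* [D] is the set of points reached from [u] by steps in [C] that are short at all times, never
   going farther than [e / 2] from [u]; it is encoded as the least step-closed set. *)
pose near_u w := forall k, mdist (iter k g u) (iter k g w) <= e / 2.
pose step a b := forall k, mdist (iter k g a) (iter k g b) <= r.
pose stepclosed P := forall a b : X, P a -> C b -> near_u b -> step a b -> P b.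
pose D : set X := [set w | forall P : set X, P u -> stepclosed P -> P w].
have Du : D u by [].
have DD : stepclosed D.
  move=> a b Da Cb nb ab P Pu sP; apply: (sP a) => //; exact: Da.
have DC w : D w -> C w /\ near_u w.
  move=> /(_ [set w | C w /\ near_u w]); apply => //.
  by split => // k; rewrite mdistxx; lra.
have tD : tame g e D.
  move=> k x y /DC[_ /(_ k) ux] /DC[_ /(_ k) uy].
  have := metric_triangle (iter k g x) (iter k g u) (iter k g y).
  rewrite (metric_sym (iter k g x) (iter k g u)); lra.
(* [D] must come as far as [e / 4] from [u]: otherwise a step out of [D] would end within
   [e / 4 + r <= e / 2] of [u], hence still in [D]. Such a step exists because [v] is outside
   [D]. *)
have [w [m [Dw um]]] : exists w m, D w /\ e / 4 <= mdist (iter m g u) (iter m g w).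
  apply: contrapT => near.
  have nD w m : D w -> mdist (iter m g u) (iter m g w) < e / 4.
    by move=> Dw; rewrite ltNge; apply/negP => um; apply: near; exists w, m.
  have nDv : ~ D v by move=> /(nD v n); lra.
  have [c [c' [Cc Dc Cc' nDc' cc']]] :
      exists c c', [/\ C c, D c, C c', ~ D c' & step c c'].
    by apply: asymptotic_fine_step => //; [exists u|exists v].
  apply: nDc'; apply: (DD c) => // k.
  have := cc' k; have := nD c k Dc.
  by have := metric_triangle (iter k g u) (iter k g c) (iter k g c'); lra.
exists D, w, m; split => //; first by move=> x /DC[].
(* Without a step leaving [P], minimality of [D] keeps all of [D] on the side of [P] on which [u]
   lies at time [k]. *)
move=> k P [_ [[a Da <-] Pa]] [_ [[b Db <-] Pb]]; apply: contrapT => nstep.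
have [Pu|nPu] := pselect (P (iter k g u)).
  have [] : D b /\ P (iter k g b); last by [].
  apply: (Db [set x | D x /\ P (iter k g x)]) => // x y [Dx Px] Cy ny xy.
  have Dy := DD x y Dx Cy ny xy; split => //; apply: contrapT => nPy.
  by apply: nstep; exists (iter k g x), (iter k g y); split => //; exists x + exists y.
have [] : D a /\ ~ P (iter k g a); last by [].
apply: (Da [set x | D x /\ ~ P (iter k g x)]) => // x y [Dx Px] Cy ny xy.
have Dy := DD x y Dx Cy ny xy; split => // Py.
apply: nstep; exists (iter k g y), (iter k g x); rewrite metric_sym.
by split => //; exists x + exists y.
Qed.

(** Kato's lemma. Ever smaller counterexamples are cut down by [tame_piece] to tame pieces that
    still spread by [e / 4] at some time, contradicting [no_persistent_spread]. *)
Lemma asymptotic_tame (e : R) : 0 < e <= d0 -> exists2 d : R, 0 < d &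
  forall C, asymptotic g C -> (forall x y, C x -> C y -> mdist x y <= d) -> tame g e C.
Proof.
move=> /andP[e0 ed]; apply: contrapT => bad.
have e40 : 0 < e / 4 by lra.
have : forall k : nat, exists t : (set X * nat) * (X * X),
    [/\ [/\ forall x y, t.1.1 x -> t.1.1 y -> mdist x y < k.+1%:R^-1 *+ 2,
            tame g e t.1.1
          & forall j, finely_connected (iter j g @` t.1.1) k.+1%:R^-1],
        t.1.1 t.2.1, t.1.1 t.2.2
      & e / 4 <= mdist (iter t.1.2 g t.2.1) (iter t.1.2 g t.2.2)].
  move=> k; apply: contrapT => nk; apply: bad.
  have k0 : 0 < k.+1%:R^-1 :> R by [].
  exists (k.+1%:R^-1) => // C aC sC n u v Cu Cv.
  rewrite leNgt; apply/negP => uv; apply: nk.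
  have r_bounds : 0 < Num.min k.+1%:R^-1 (e / 4) <= e / 4.
    by rewrite lt_min k0 e40 ge_min lexx orbT.
  have [D [w [m [DC tD fD [Du Dw] um]]]] := tame_piece r_bounds aC Cu Cv uv.
  exists ((D, m), (u, w)); split => //; split => //=.
    move=> x y /DC Cx /DC Cy; apply: le_lt_trans (sC x y Cx Cy) _.
    by rewrite mulr2n ltrDl.
  move=> j P P1 P2; have [c [c' [? ? ? ? cc']]] := fD j P P1 P2.
  exists c, c'; split => //; apply: le_trans cc' _.
  by rewrite ge_min lexx.
move=> /choice [t tP].
apply: (@no_persistent_spread (fun k => (t k).1.1) (fun k => (t k).1.2)
          (fun k => (t k).2.1) (fun k => (t k).2.2) (e / 4)).
- by [].
(* The spreading times tend to infinity: the pieces shrink, so their first [N] iterates eventually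
   stay within [e / 8], below the spread [e / 4]. *)
- move=> N; have e80 : 0 < e / 8 by lra.
  have [d dd0 Hd] := uniformly_continuous_iter X_compact F_infty N g_cont e80.
  have d20 : 0 < d / 2 by lra.
  apply: filterS (near_invS F_infty d20) => k kd; rewrite leqNgt; apply/negP => mN.
  have [[sD _ _] Du Dw um] := tP k.
  have close : mdist (t k).2.1 (t k).2.2 < d.
    by apply: lt_trans (sD _ _ Du Dw) _; rewrite mulr2n [ltRHS]splitr ltrD.
  by have := Hd _ _ _ mN close; lra.
- by move=> k; have [[_ tD _] _ _ _] := tP k => n x y Dx Dy;
  exact: le_trans (tD n x y Dx Dy) ed.
- by move=> k; have [[_ _ fD] _ _ _] := tP k; exact: fD.
- by move=> k; have [] := tP k.
- by move=> k; have [] := tP k.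
- by move=> k; have [] := tP k.
Qed.

Lemma joined_Qmap (e : R) Y x y : e <= d0 ->
  joined g e Y x y -> Qmap (asymptotic g) Y x y.
Proof.
move=> ed [C [cC tC CY Cx Cy]]; exists C; split => //.
exact: tame_asymptotic ed cC tC.
Qed.

(** On a small [Y] the leaf relation coincides with being joined at scale [e]. Two joining continua
    together are tame at scale [e + e <= d0], hence asymptotic, hence tame at scale [e] again by
    Kato's lemma; this gives transitivity. Closedness under limits, from [joined_lim], gives closed
    leaves and upper semicontinuity. *)
Lemma small_leaves (e : R) : 0 < e -> e + e <= d0 -> exists2 d : R, 0 < d &
  forall Y, closed Y -> (forall x y, Y x -> Y y -> mdist x y <= d) ->
  [/\ forall x, Qmap (asymptotic g) Y x `<=` joined g e Y x,
      decomposition Y (Qmap (asymptotic g) Y)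
    & forall x, Y x -> asymptotic g (Qmap (asymptotic g) Y x)].
Proof.
move=> e0 ed; have ed0 : e <= d0 by lra.
have [d dd0 Hd] := asymptotic_tame (introT andP (conj e0 ed0)).
exists d => // Y cY sY; set Q := Qmap (asymptotic g) Y.
have tame_in C : asymptotic g C -> C `<=` Y -> tame g e C.
  by move=> aC CY; apply: Hd => // x y /CY Yx /CY Yy; exact: sY.
have QE x y : Q x y <-> joined g e Y x y.
  split; last exact: joined_Qmap.
  by move=> [C [aC CY Cx Cy]]; exists C; split => //; [case: aC|exact: tame_in].
have QY x y : Q x y -> Y y by move=> [C [_ CY _ Cy]]; exact: CY.
have Qsym x y : Q x y -> Q y x by move=> [C [*]]; exists C.
have Qtrans x y z : Q x y -> Q y z -> Q x z.
  by move=> /QE xy /QE yz; exact: joined_Qmap ed (joined_trans xy yz).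
have Qxx x : Y x -> Q x x.
  move=> Yx; apply/QE; exists [set x]; split => //; last by move=> _ ->.
    by split; [exact: compact_set1|exact: connected1].
  by move=> n _ _ -> ->; rewrite mdistxx; exact: ltW.
have Qclosed x : Y x -> closed (Q x).
  move=> Yx z clz.
  have : forall k : nat, exists y, Q x y /\ mdist z y < k.+1%:R^-1.
    move=> k; have k0 : 0 < k.+1%:R^-1 :> R by [].
    have [y [xy]] := clz _ (nbhsx_ballx z _ k0).
    by rewrite ballEmdist => zy; exists y.
  move=> /choice [y yP]; apply/QE.
  apply: (@joined_lim _ _ X_compact _ _ F_infty g e Y (fun=> x) y) => //.
  - exact: cvg_cst.
  - apply/cvg_mdist => r r0.
    by apply: filterS (near_invS F_infty r0) => k; apply: lt_trans; have [] := yP k.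
  - by apply: nearW => k; apply/QE; have [] := yP k.
have Qcont x : Y x -> continuum (Q x).
  move=> Yx; split; first exact: (subclosed_compact (Qclosed x Yx) X_compact).
  (* A leaf is a union of connected sets through [x]. *)
  have -> : Q x = \bigcup_(C in [set C | [/\ asymptotic g C, C `<=` Y & C x]]) C.
    apply/seteqP; split => [y [C [aC CY Cx Cy]]|y [C [aC CY Cx] Cy]].
      by exists C.
    by exists C.
  by apply: bigcup_connected => [|C [[[]]]//]; exists x => C [].
have Qtame x : tame g e (Q x).
  move=> n y z /Qsym yx xz.
  have /QE yz := Qtrans _ _ _ yx xz.
  exact: joined_mdist n yz.
split.
- by move=> x y /QE.
- split.
  + by move=> x Yx; split; [exists x; exact: Qxx|exact: QY|exact: Qcont].
  + exact: Qxx.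
  + move=> x y Yx Yy; have [[z [xz yz]]|n] := pselect (Q x `&` Q y !=set0).
      by left; apply/seteqP; split => w xw;
        [apply: (Qtrans y z w yz)|apply: (Qtrans x z w xz)];
        apply: (Qtrans z _ w _ xw); exact: Qsym.
    by right; apply/eqP; rewrite -[_ == _]negbK; apply/negP => /set0P.
  + move=> x Yx V oV QV; apply: contrapT => nV.
    have : forall k : nat, exists yw : X * X,
        [/\ mdist x yw.1 < k.+1%:R^-1, Q yw.1 yw.2 & ~ V yw.2].
      move=> k; apply: contrapT => nk; apply: nV.
      have k0 : 0 < k.+1%:R^-1 :> R by [].
      apply: filterS (nbhsx_ballx x _ k0) => y; rewrite ballEmdist => xy Yy w yw.
      by apply: contrapT => nVw; apply: nk; exists (y, w).
    move=> /choice [yw ywP].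
    have [w yww] := ultra_cvg X_compact (fun k => (yw k).2).
    have yx : (fun k => (yw k).1) @ F --> x.
      apply/cvg_mdist => r r0.
      by apply: filterS (near_invS F_infty r0) => k; apply: lt_trans; have [] := ywP k.
    have /QE /QV Vw : joined g e Y x w.
      apply: (joined_lim X_compact F_infty g_cont cY yx yww).
      by apply: nearW => k; apply/QE; have [] := ywP k.
    have /filter_ex [k Vk] : \forall k \near F, V (yw k).2.
      exact: yww (open_nbhs_nbhs (conj oV Vw)).
    by have [_ _] := ywP k; apply.
- by move=> x Yx; apply: tame_asymptotic ed0 (Qcont _ Yx) (Qtame x).
Qed.

Lemma small_balls_atlas (e : R) : 0 < e -> e + e <= d0 -> exists2 r0 : R, 0 < r0 &
  forall z r, r <= r0 -> let U := ball z r in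
    Qdom (asymptotic g) U /\
    forall x, Qmap (asymptotic g) (closure U) x `<=` joined g e setT x.
Proof.
move=> e0 ed; have [d dd0 Hd] := small_leaves e0 ed; exists (d / 2); first by lra.
move=> z r rd U.
have Uz x : closure U x -> mdist z x <= r.
  move=> Ux; apply/ler_addgt0Pl => s s0.
  have [y []] := Ux _ (nbhsx_ballx x _ s0).
  rewrite /U !ballEmdist /= => zy xy.
  by have := metric_triangle z y x; rewrite (metric_sym y); lra.
have [|Qj dec asy] := Hd (closure U) (@closed_closure _ U).
  move=> x y /Uz zx /Uz zy.
  by have := metric_triangle x z y; rewrite (metric_sym x z); lra.
split; first by split => //; exact: open_ball.
by move=> x y /Qj [C [*]]; exists C.
Qed.

End Separation.

(** * Generating pairs and shadowing *)

Section GeneratingPairs.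
Context {R : realType} {X : metricType R}.
Hypothesis X_compact : compact [set: X].
Context {F : set_system nat} {FU : UltraFilter F}.
Hypothesis F_infty : \oo `<=` F.
Variables (g h : X -> X) (d0 : R).
Hypotheses (g_cont : continuous g) (h_cont : continuous h).
Hypotheses (gK : cancel g h) (hK : cancel h g).
Hypothesis d0_gt0 : 0 < d0.
Hypothesis separating : forall A B, continuum A -> continuum B ->
  tame g d0 A -> tame h d0 B -> is_subset1 (A `&` B).
Hypothesis generating : forall (e : R) z, 0 < e -> exists2 d : R, 0 < d &
  forall y, mdist z y < d ->
    (exists a, joined g e setT z a /\ joined h e setT y a) /\
    (exists c, joined h e setT z c /\ joined g e setT y c).

Lemma joined_both (e e' : R) x y : e <= d0 -> e' <= d0 ->
  joined g e setT x y -> joined h e' setT x y -> x = y.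
Proof.
move=> ed e'd [A [cA tA _ Ax Ay]] [B [cB tB _ Bx By]].
apply: (separating cA cB) => // n a b Ha Hb.
  exact: le_trans (tA n a b Ha Hb) ed.
exact: le_trans (tB n a b Ha Hb) e'd.
Qed.

(* Near z, the projections of x and c to the h-leaf of z along g-leaves are
   joined both by a g-tame and by an h-tame continuum, hence coincide. *)
Lemma joined_refine (e : R) : 0 < e -> exists2 d : R, 0 < d &
  forall x c, mdist x c < d -> joined g (d0 / 4) setT x c -> joined g e setT x c.
Proof.
move=> e0; apply: (uniformly_local X_compact F_infty) => z.
(* The bound [d0 / 4] keeps the total [d0 / 4 + 2 s] below [d0], as [joined_both] demands; the bound
   [e / 2] gives the final scale [2 s <= e]. *)
have s0 : 0 < Num.min (e / 2) (d0 / 4) by rewrite lt_min !divr_gt0.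
set s := Num.min _ _ in s0.
have se : s <= e / 2 by rewrite ge_min lexx.
have sd : s <= d0 / 4 by rewrite ge_min lexx orbT.
have [d dd0 Hd] := generating z s0; exists d => // x c zx zc xc.
have [_ [p [zp xp]]] := Hd x zx; have [_ [q [zq cq]]] := Hd c zc.
have pq : p = q.
  apply: (@joined_both (s + (d0 / 4 + s)) (s + s)); [by lra|by lra| |].
    exact: joined_trans (joined_sym xp) (joined_trans xc cq).
  exact: joined_trans (joined_sym zp) zq.
apply: (@joined_le _ _ g (s + s)); first by lra.
by apply: joined_trans xp _; rewrite pq; exact: joined_sym.
Qed.

(** For a nearby centre [z], the points [a] and [b] are the projections of [x] and [y] to the
    [g]-leaf of [z] along [h]-leaves. *)
Lemma joined_chain (e : R) : 0 < e -> exists2 d : R, 0 < d &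
  forall x y, mdist x y < d ->
  exists a b, [/\ joined h e setT x a, joined g e setT a b & joined h e setT y b].
Proof.
move=> e0; apply: (uniformly_local X_compact F_infty) => z.
have e20 : 0 < e / 2 by lra.
have [d dd0 Hd] := generating z e20; exists d => // x y zx zy.
have [[a [za xa]] _] := Hd x zx; have [[b [zb yb]] _] := Hd y zy.
exists a, b; split.
- by apply: joined_le xa; lra.
- by rewrite [e]splitr; exact: joined_trans (joined_sym za) zb.
- by apply: joined_le yb; lra.
Qed.

(** Applying [h] to a [g]-tame continuum adds only one new time, time 0, which uniform continuity of
    [h] controls. *)
Lemma joined_pullback : exists2 e : R, 0 < e <= d0 / 4 &
  forall x y, joined g e setT x y -> joined g (d0 / 4) setT (h x) (h y).
Proof.
have d40 : 0 < d0 / 4 by rewrite divr_gt0.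
have [d dd0 Hd] := uniformly_continuous X_compact F_infty h_cont d40.
exists (Num.min (d / 2) (d0 / 4)).
  by rewrite lt_min ge_min lexx orbT andbT; apply/andP; split; lra.
move=> x y [C [cC tC _ Cx Cy]]; exists (h @` C); split => //.
- exact: continuum_image.
- move=> [|n] _ _ [a Ca <-] [b Cb <-].
    apply: Hd; have := tC 0 a b Ca Cb; rewrite le_min => /andP[/= + _]; lra.
  rewrite !iterSr !hK; have := tC n a b Ca Cb.
  by rewrite le_min => /andP[].
Qed.

Lemma shadowing_joined : exists2 d : R, 0 < d & forall x y,
  (forall n, mdist (iter n g x) (iter n g y) < d) -> joined g (d0 / 4) setT x y.
Proof.
have [e1 /andP[e10 e1d] pull] := joined_pullback.
have [ds ds0 refine] := joined_refine e10.
(* The three bounds serve in turn to start the pullback at scale [e1], to keep the pulled-back ends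
   close, and to contract the [h]-continua. *)
set e2 := Num.min (Num.min e1 (ds / 4)) d0.
have e20 : 0 < e2 by rewrite !lt_min e10 d0_gt0 andbT /=; lra.
have e2e1 : e2 <= e1 by rewrite !ge_min lexx.
have e2s : e2 <= ds / 4 by rewrite !ge_min lexx orbT.
have e2d : e2 <= d0 by rewrite !ge_min lexx orbT.
have [dc dc0 chain] := joined_chain e20.
exists (Num.min dc (ds / 4)); first by rewrite lt_min dc0 /=; lra.
move=> x y xy.
have close n : mdist (iter n g x) (iter n g y) < ds / 4.
  by have := xy n; rewrite lt_min => /andP[].
have : forall n : nat, exists ab : X * X, [/\ joined h e2 setT (iter n g x) ab.1,
    joined g e2 setT ab.1 ab.2 & joined h e2 setT (iter n g y) ab.2].
  move=> n; have [|a [b H]] := chain (iter n g x) (iter n g y).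
    by have := xy n; rewrite lt_min => /andP[].
  by exists (a, b).
move=> /choice [ab abP].
(* Each pullback may lengthen the join to [d0 / 4]; its ends stay within [3 ds / 4] of each other,
   through the orbits of [x] and [y], so [refine] restores the scale [e1]. *)
have pulled n j : (j <= n)%N ->
    joined g e1 setT (iter j h (ab n).1) (iter j h (ab n).2).
  have [xa ab_j yb] := abP n.
  elim: j => [_|j IH jn] /=; first exact: joined_le e2e1 ab_j.
  apply: refine; last exact: pull (IH (ltnW jn)).
  have := joined_mdist j.+1 xa; have := joined_mdist j.+1 yb.
  rewrite !(iter_cancel gK)// !iterS; have := close (n - j.+1)%N.
  set x' := iter _ g x; set y' := iter _ g y.
  set b' := h _; set a' := h _.
  have := metric_triangle a' x' b'; have := metric_triangle x' y' b'.
  rewrite (metric_sym a' x'); lra.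
(* Since [h^n] undoes [g^n], this is [uniform_contraction] with [g] and [h] exchanged. *)
have shadow (w : X) (c : nat -> X) :
    (forall n, joined h e2 setT (iter n g w) (c n)) ->
    (fun n => iter n h (c n)) @ F --> w.
  move=> wc; apply/cvg_mdist => r r0.
  have r20 : 0 < r / 2 by lra.
  have separating' A B : continuum A -> continuum B ->
      tame h d0 A -> tame g d0 B -> is_subset1 (A `&` B).
    by move=> cA cB tA tB; rewrite setIC; exact: separating.
  have [N HN] :=
    uniform_contraction X_compact F_infty h_cont g_cont hK separating' r20.
  apply: filterS (near_geq F_infty N) => n Nn.
  have [C [cC tC _ Cw Cc]] := wc n.
  have tC' : tame h d0 C by move=> k u v Cu Cv; exact: le_trans (tC k u v Cu Cv) e2d.
  have := HN C n _ _ cC tC' Nn Cw Cc.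
  by rewrite (iter_cancel gK)// subnn /=; lra.
apply: (joined_le e1d).
apply: (joined_lim X_compact F_infty g_cont closedT
  (shadow x (fun n => (ab n).1) _) (shadow y (fun n => (ab n).2) _)).
- by move=> n; have [] := abP n.
- by move=> n; have [] := abP n.
- by apply: nearW => n; exact: pulled.
Qed.

End GeneratingPairs.

(** * From diameters and atlases to pointwise estimates *)

Section Homeomorphisms.
Context {R : realType} {X : metricType R}.
Hypothesis X_compact : compact [set: X].
Context {F : set_system nat} {FU : UltraFilter F}.
Hypothesis F_infty : \oo `<=` F.
Implicit Types (f : homeo X) (A C : set X).

(** Boundedness makes the [sup] in [diam] a genuine supremum. *)
Lemma mdist_bounded : exists M : R, forall x y : X, mdist x y <= M.
Proof.
apply: contrapT => unb.
have : forall k : nat, exists xy : X * X, k%:R < mdist xy.1 xy.2.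
  move=> k; apply: contrapT => nk; apply: unb; exists k%:R => x y.
  by rewrite leNgt; apply/negP => xy; apply: nk; exists (x, y).
move=> /choice [xy xyP].
have [p xp] := ultra_cvg X_compact (fun k => (xy k).1).
have [q yq] := ultra_cvg X_compact (fun k => (xy k).2).
move/cvg_mdist : xp => /(_ 1 ltr01) xp.
move/cvg_mdist : yq => /(_ 1 ltr01) yq.
have big : \forall k \near F, mdist p q + 2 < k%:R.
  by apply: F_infty; exact: nbhs_infty_gtr.
have [k [[pk qk] kb]] := filter_ex (filterI (filterI xp yq) big).
have := xyP k; have := metric_triangle (xy k).1 p (xy k).2.
have := metric_triangle p q (xy k).2; rewrite (metric_sym (xy k).1 p); lra.
Qed.

Lemma diam_le A (e : R) : 0 <= e ->
  (forall x y, A x -> A y -> mdist x y <= e) -> diam A <= e.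
Proof.
move=> e0 Ae; rewrite /diam; set D := [set _ | _ in _ & _ in _].
have [D0|/set0P/negP/negPn/eqP ->] := pselect (D !=set0); last by rewrite sup0.
by apply: ge_sup => // _ [x Ax [y Ay <-]]; exact: Ae.
Qed.

Lemma mdist_le_diam A x y : A x -> A y -> mdist x y <= diam A.
Proof.
move=> Ax Ay; apply: ub_le_sup; last by exists x => //; exists y.
by have [M HM] := mdist_bounded; exists M => _ [a _ [b _ <-]].
Qed.

Lemma diam_ge0 A : 0 <= diam A.
Proof.
have [[x Ax]|/set0P/negP/negPn/eqP ->] := pselect (A !=set0).
  by apply: le_trans (mdist_le_diam Ax Ax); exact: mdist_ge0.
rewrite /diam (_ : [set _ | _ in _ & _ in _] = set0) ?sup0//.
by apply/seteqP; split => // r [? []].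
Qed.

Lemma asymptotic_diam (g : X -> X) C : asymptotic g C <->
  continuum C /\ diam (iter n g @` C) @[n --> \oo] --> (0 : R).
Proof.
split=> -[cC sC]; split => //.
  apply/cvgrPdist_le => e e0; have [N HN] := sC e e0; exists N => // n /= Nn.
  rewrite sub0r normrN ger0_norm ?diam_ge0//; apply: diam_le; first exact: ltW.
  by move=> _ _ [x Cx <-] [y Cy <-]; exact: HN.
move=> e e0; have /cvgrPdist_le /(_ e e0) [N _ HN] := sC.
exists N => n x y Nn Cx Cy; have := HN n Nn.
rewrite sub0r normrN ger0_norm ?diam_ge0//; apply: le_trans.
by apply: mdist_le_diam; [exists x|exists y].
Qed.

Lemma stableE f : stable f = asymptotic f.
Proof. by apply/seteqP; split => C /asymptotic_diam. Qed.

Lemma iterzN f (n : nat) : iterz f (- n%:Z) = iter n (homeo_inv f).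
Proof. by case: n. Qed.

Lemma unstableE f : unstable f = asymptotic (homeo_inv f).
Proof.
have E C : (fun n : nat => diam (iterz f (- n%:Z) @` C)) =
           (fun n : nat => diam (iter n (homeo_inv f) @` C)).
  by apply/funext => n; rewrite iterzN.
by apply/seteqP; split => C; rewrite /unstable E => /asymptotic_diam.
Qed.

Lemma separating_tame f (d : R) : 0 < d ->
  (forall A B, continuum A -> continuum B ->
    (forall n : int, 0 <= n -> diam (iterz f n @` A) <= d) ->
    (forall n : int, n <= 0 -> diam (iterz f n @` B) <= d) ->
    is_subset1 (A `&` B)) ->
  forall A B, continuum A -> continuum B ->
    tame f d A -> tame (homeo_inv f) d B -> is_subset1 (A `&` B).
Proof.
move=> d0 cw A B cA cB tA tB; apply: cw => // n n0; apply: diam_le; try exact: ltW.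
  by case: n n0 => n // _ _ _ [x Ax <-] [y Ay <-]; exact: (tA n).
have -> : n = - `|n|%N%:Z by lia.
by rewrite iterzN => _ _ [x Bx <-] [y By <-]; exact: tB.
Qed.

(** The generating condition speaks only of balls in both atlases, which [small_balls_atlas]
    provides for [f] and its inverse. A local leaf lies in the leaf of the closed ball, whose points
    are joined at scale [s]. *)
Lemma generating_joined f (d0 e : R) z : 0 < d0 ->
  (forall A B, continuum A -> continuum B ->
    tame f d0 A -> tame (homeo_inv f) d0 B -> is_subset1 (A `&` B)) ->
  generating_pair (stable_atlas f) (unstable_atlas f) ->
  0 < e -> exists2 d : R, 0 < d & forall y, mdist z y < d ->
    (exists a, joined f e setT z a /\ joined (homeo_inv f) e setT y a) /\
    (exists c, joined (homeo_inv f) e setT z c /\ joined f e setT y c).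
Proof.
move=> d00 sep gp e0; set s := Num.min e (d0 / 2).
have s0 : 0 < s by rewrite lt_min e0 divr_gt0.
have ss : s + s <= d0 by rewrite [leRHS]splitr lerD// ge_min lexx orbT.
have se : s <= e by rewrite ge_min lexx.
have fc := @homeo_fun_continuous _ f; have ic := @homeo_inv_continuous _ f.
have sep' A B : continuum A -> continuum B ->
    tame (homeo_inv f) d0 A -> tame f d0 B -> is_subset1 (A `&` B).
  by move=> cA cB tA tB; rewrite setIC; exact: sep.
have [r r0 Hr] := small_balls_atlas X_compact F_infty fc ic (@homeo_funK _ f) sep s0 ss.
have [r' r'0 Hr'] :=
  small_balls_atlas X_compact F_infty ic fc (@homeo_invK _ f) sep' s0 ss.
set t := Num.min r r'.
have t0 : 0 < t by rewrite lt_min r0.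
have [|sdom sleaf] := Hr z t; first by rewrite ge_min lexx.
have [|udom uleaf] := Hr' z t; first by rewrite ge_min lexx orbT.
have := gp z t t0; rewrite /stable_atlas /unstable_atlas stableE unstableE.
move=> /(_ sdom udom) [d dd0 Hd]; exists d => // y zy.
have [|[a [/connected_component_sub[+ _] /connected_component_sub[+ _]]]
        [c [/connected_component_sub[+ _] /connected_component_sub[+ _]]]] := Hd y.
  by rewrite ballEmdist.
move=> /sleaf za /uleaf ya /uleaf zc /sleaf yc.
by split; [exists a|exists c]; split; exact: joined_le se _.
Qed.

End Homeomorphisms.

Theorem theorem5p3p4 (R : realType) (X : metricType R) (f : homeo X) :
  continuum [set: X] ->
  cw1_expansive f ->
  generating_pair (stable_atlas f) (unstable_atlas f) ->
  expansive f.
Proof.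
move=> [X_compact _] [d0 d00 /(separating_tame d00) sep] gp.
have [F [FU F_infty]] := ultraFilterLemma eventually_filter.
have fc := @homeo_fun_continuous _ f; have ic := @homeo_inv_continuous _ f.
have sep' A B : continuum A -> continuum B ->
    tame (homeo_inv f) d0 A -> tame f d0 B -> is_subset1 (A `&` B).
  by move=> cA cB tA tB; rewrite setIC; exact: sep.
have gen e z := @generating_joined _ _ X_compact F FU F_infty f d0 e z d00 sep gp.
(* Reversing time only swaps the two halves of the condition. *)
have gen' (e : R) z (e0 : 0 < e) : exists2 d : R, 0 < d & forall y, mdist z y < d ->
    (exists a, joined (homeo_inv f) e setT z a /\ joined f e setT y a) /\
    (exists c, joined f e setT z c /\ joined (homeo_inv f) e setT y c).
  by have [d dd0 Hd] := gen e z e0; exists d => // y /Hd[].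
have [d dd0 stable_joined] := shadowing_joined X_compact F_infty fc ic
  (@homeo_funK _ f) (@homeo_invK _ f) d00 sep gen.
have [d' d'0 unstable_joined] := shadowing_joined X_compact F_infty ic fc
  (@homeo_invK _ f) (@homeo_funK _ f) d00 sep' gen'.
exists (Num.min d d'); first by rewrite lt_min dd0.
move=> x y xy; have d4 : d0 / 4 <= d0 by lra.
(* Close forward orbits give a stable continuum through [x] and [y], close backward orbits an
   unstable one. *)
apply: (joined_both sep d4 d4).
  by apply: stable_joined => n; have := xy n%:Z; rewrite lt_min => /andP[].
by apply: unstable_joined => n; have := xy (- n%:Z); rewrite iterzN lt_min => /andP[].
Qed.
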